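(* Let $p=1$, let $\Lambda\subset\mathbb{C}$ be nonempty and bounded, and let $s\ge 1$ be an integer. Let the initial value $h_{\max}>0$ be large enough that $r_{1,s}(h_{\max},\Lambda)>0$. Let $H_{\mathrm{opt}}$ denote the optimal step size for $(\Lambda,p,s)$, and for $\epsilon>0$ let $H_\epsilon$ denote the output of the simple bisection algorithm (with $p=1$, this $h_{\max}$ and tolerance $\epsilon$). Then $$\lim_{\epsilon\to 0^+} H_\epsilon = H_{\mathrm{opt}}.$$
   Context: For integers $1\le p\le s$, an admissible stability polynomial is $R(z)=\sum_{j=0}^s a_j z^j$ with $a_j=1/j!$ for $0\le j\le p$, and with $a_{p+1},\dots,a_s\in\mathbb{R}$ free. (When $s=p$ there are no free coefficients.) Least deviation: for $h\ge 0$ and bounded $\Lambda\subset\mathbb{C}$, $$r_{p,s}(h,\Lambda)=\min_{a_{p+1},\dots,a_s}\ \sup_{\lambda\in\Lambda}\bigl(|R(h\lambda)|-1\bigr),$$ the minimum being over admissible polynomials. Optimal step size: $H_{\mathrm{opt}}$ is the maximum of all $h\ge 0$ for which there is an admissible $R$ with $|R(h\lambda)|\le 1$ for all $\lambda\in\Lambda$. Simple bisection algorithm (exact arithmetic; input: $\Lambda,p,s$, tolerance $\epsilon>0$, initial $h_{\max}$): set $h_{\min}=0$. While $h_{\max}-h_{\min}>\epsilon$: set $h=(h_{\max}+h_{\min})/2$ and compute $r_{p,s}(h,\Lambda)$; if $r_{p,s}(h,\Lambda)\le 0$, set $h_{\min}=h$; otherwise set $h_{\max}=h$. When the loop ends,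 return $H_\epsilon=h_{\min}$. *)

(* Defs.v *)
From HB Require Import structures.
From mathcomp Require Import all_boot all_order all_algebra.
From mathcomp Require Import all_classical all_reals all_analysis.
From mathcomp Require Export complex.

Set Implicit Arguments.
Unset Strict Implicit.
Unset Printing Implicit Defensive.

Import Order.TTheory GRing.Theory Num.Theory.
Import numFieldNormedType.Exports.

Local Open Scope classical_set_scope.
Local Open Scope ring_scope.

Section StepSize.
Variable R : realType.

(* The modulus [`|z|] of [z : R[i]] is itself an element of [R[i]];
   [normc z : R] is the same number in [R]. *)
Local Notation normc := (@ComplexField.Normc.normc R).

Definition is_maximum (A : set R) (x : R) : Prop := A x /\ ubound A x.

Definition is_minimum (A : set R) (x : R) : Prop := A x /\ lbound A x.

Definition admissible (p s : nat) : set {poly R} :=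
  [set q | (size q <= s.+1)%N /\
           forall j, (j <= p)%N -> q`_j = (j`!%:R)^-1].

(* [ceval q z] is q(z) for a real polynomial q at a complex point z. *)
Definition ceval (q : {poly R}) (z : R[i]) : R[i] :=
  (map_poly (real_complex R) q).[z].

Definition deviation (q : {poly R}) (h : R) (Lambda : set R[i]) : R :=
  sup [set normc (ceval q (h%:C%C * l)) - 1 | l in Lambda].

(* For nonempty bounded [Lambda] the minimum is attained, so the default value
   of [get] plays no role; likewise in [H_opt] (when the admissible step sizes
   are bounded) and in [H_bisection] (for a positive tolerance). *)
Definition least_deviation (p s : nat) (h : R) (Lambda : set R[i]) : R :=
  get (is_minimum [set deviation q h Lambda | q in admissible p s]).

Definition stable_steps (p s : nat) (Lambda : set R[i]) : set R :=
  [set h | 0 <= h /\ exists2 q, admissible p s q &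
     forall l, Lambda l -> normc (ceval q (h%:C%C * l)) <= 1].

Definition H_opt (p s : nat) (Lambda : set R[i]) : R :=
  get (is_maximum (stable_steps p s Lambda)).

(* [bisection p s Lambda eps hmin hmax H]: the loop started in the state
   [(hmin, hmax)] terminates and returns [H]. *)
Inductive bisection (p s : nat) (Lambda : set R[i]) (eps : R) :
    R -> R -> R -> Prop :=
| bisection_stop hmin hmax :
    hmax - hmin <= eps -> bisection p s Lambda eps hmin hmax hmin
| bisection_accept hmin hmax H :
    eps < hmax - hmin ->
    least_deviation p s ((hmax + hmin) / 2) Lambda <= 0 ->
    bisection p s Lambda eps ((hmax + hmin) / 2) hmax H ->
    bisection p s Lambda eps hmin hmax H
| bisection_reject hmin hmax H :
    eps < hmax - hmin ->
    0 < least_deviation p s ((hmax + hmin) / 2) Lambda ->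
    bisection p s Lambda eps hmin ((hmax + hmin) / 2) H ->
    bisection p s Lambda eps hmin hmax H.

Definition H_bisection (p s : nat) (Lambda : set R[i]) (hmax eps : R) : R :=
  get (bisection p s Lambda eps 0 hmax).

End StepSize.

(* Main.v *)
Require Import Defs.
From mathcomp Require Import all_boot all_order all_algebra.
From mathcomp Require Import all_classical all_reals all_analysis.
From mathcomp Require Import complex.
From mathcomp Require Import ring lra.
Import Order.TTheory GRing.Theory Num.Theory.
Import numFieldNormedType.Exports.
Local Open Scope classical_set_scope.
Local Open Scope ring_scope.

(** Normalising the linear coefficient to the step size turns the problem into
    a convex one: replacing R(z) by R(hz), a step h > 0 is stable exactly when
    some real polynomial 1 + h z + c_2 z^2 + ... + c_s z^s is bounded by 1 in
    modulus on Lambda ([stable_stepsP]). Scaling both h and c by a factor a in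
    [0, 1] replaces such a polynomial P by (1 - a) + a P, which is again bounded
    by 1. Hence the stable steps form an interval starting at 0
    ([stable_steps_down]); this is where p = 1 is used.

    The bisection keeps a stable lower end and an unstable upper end, provided
    the test r <= 0 really decides stability ([least_deviation_le0]). By the
    interval property it then brackets H_opt, and it returns a value within
    epsilon of it ([bisection_bracket]).

    Two extrema have to be attained: the minimal deviation, without which
    r <= 0 would say nothing about stability ([least_deviationP]), and the
    maximal stable step ([H_optP]). Both follow from one compactness statement,
    [compact_feasible]. Its difficulty is that the free coefficients need not
    be bounded, since when Lambda is finite different polynomials may coincide
    on it. However, the coefficients can always be replaced by bounded ones
    giving the same values on Lambda ([bounded_representative]). *)

Set Implicit Arguments.
Unset Strict Implicit.
Unset Printing Implicit Defensive.

(** * Bounded coefficients and compactness *)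

(** Among the vectors [phi t] pick finitely many, the rows of a matrix [A], that
    span all of them. A coefficient vector [c] matters only through its values
    [c *m A^T], and a pseudo-inverse of [A^T] recovers from these values a
    representative depending linearly, hence boundedly, on them. *)
Lemma bounded_representative (F : realFieldType) (k : nat) (T : Type)
    (D : set T) (phi : T -> 'rV[F]_k) :
  exists C : F, forall (c : 'rV_k) (M : F),
    (forall t, D t -> `|(c *m (phi t)^T) 0 0| <= M) ->
    exists2 c' : 'rV_k,
      (forall t, D t -> c' *m (phi t)^T = c *m (phi t)^T) &
      (forall j, `|c' 0 j| <= C * M).
Proof.
pose P n := `[< exists m, exists2 A : 'M[F]_(m, k),
  (forall i, exists2 t, D t & row i A = phi t) & \rank A = n >].
have exP : exists n, P n.
  exists 0%N; apply/asboolP; exists 0%N; exists 0; last by rewrite mxrank0.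
  by case.
have ubP n : P n -> (n <= k)%N.
  by move=> /asboolP[m [A _ <-]]; exact: rank_leq_col.
(* A choice of rows of maximal rank spans every other vector of the family. *)
case: (ex_maxnP exP ubP) => n /asboolP[m [A rowA rkA]] maxn.
have spanA t : D t -> (phi t <= A)%MS.
  move=> Dt; have sA : (A <= col_mx A (phi t))%MS.
    by rewrite -addsmxE addsmxSl.
  have rk_le : (\rank (col_mx A (phi t)) <= n)%N.
    apply/maxn/asboolP; exists (m + 1)%N; exists (col_mx A (phi t)) => // i.
    case: (split_ordP i) => j ->.
      by have [u Du rj] := rowA j; exists u => //; rewrite rowKu.
    by exists t => //; rewrite rowKd; apply/rowP => l; rewrite mxE ord1.
  have [_ /esym eqr] := mxrank_leqif_sup sA.
  have : (col_mx A (phi t) <= A)%MS.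
    by rewrite eqr eqn_leq (mxrankS sA) rkA rk_le.
  by apply: submx_trans; rewrite -addsmxE addsmxSr.
pose B := pinvmx A^T.
exists (\sum_i \sum_j `|B i j|) => c M cM.
have cA i : `|(c *m A^T) 0 i| <= M.
  have [t Dt rt] := rowA i; have := cM t Dt; rewrite -rt.
  by rewrite !mxE; under eq_bigr do rewrite !mxE;
    under [in X in _ -> X]eq_bigr do rewrite !mxE.
exists (c *m A^T *m B) => [t Dt|j].
  have /submxP[E ->] := spanA t Dt.
  by rewrite trmx_mul 2!(mulmxA _ A^T) mulmxKpV // submxMl.
rewrite mxE (le_trans (ler_norm_sum _ _ _))// mulr_suml ler_sum// => i _.
rewrite normrM mulrC (le_trans (ler_wpM2l _ (cA i)))//.
have M0 : 0 <= M := le_trans (normr_ge0 _) (cA i).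
by rewrite ler_wpM2r// (bigD1 j)//= lerDl sumr_ge0.
Qed.

Section StabilityPolynomials.
Variable R : realType.
Local Notation normc := (@ComplexField.Normc.normc R).
Import ComplexField.Normc.

Lemma normc_triangle (x y : R[i]) : normc (x + y) <= normc x + normc y.
Proof. exact: le_normcD. Qed.

Lemma normc_opp (x : R[i]) : normc (- x) = normc x.
Proof. exact: normcN. Qed.

Lemma normc_ge0 (x : R[i]) : 0 <= normc x.
Proof. by case: x => a b; rewrite sqrtr_ge0. Qed.

Lemma normc_real (a : R) : normc a%:C%C = `|a|.
Proof. by rewrite /= expr0n addr0 sqrtr_sqr. Qed.

Lemma normr_Re_le (z : R[i]) : `|complex.Re z| <= normc z.
Proof. by case: z => a b /=; rewrite -sqrtr_sqr ler_wsqrtr// lerDl sqr_ge0. Qed.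

(** A bound on a modulus is a family of bounds on real parts, that is, on real
    linear functionals; this reduces complex constraints to real ones. *)
Lemma normc_le_dual (z : R[i]) (d : R) :
  normc z <= d <-> forall w, normc w <= 1 -> `|complex.Re (w * z)| <= d.
Proof.
split=> [zd w w1|].
  apply: le_trans (normr_Re_le _) _; rewrite normcM -[d]mul1r.
  by rewrite ler_pM// normc_ge0.
have [->|z0] := eqVneq z 0.
  by move=> /(_ 0); rewrite mul0r normr0 normc0; apply.
have nz : 0 < normc z.
  by rewrite lt0r normc_ge0 andbT; apply: contra_neq z0 => /eq0_normc.
(* The rotation that takes [z] to its modulus. *)
move=> /(_ ((normc z)^-1%:C%C * (z^*)%C)).
have -> : complex.Re ((normc z)^-1%:C%C * (z^*)%C * z) = normc z.
  case: z nz {z0} => a b nz; simpc => /=.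
  have e : Num.sqrt (a ^+ 2 + b ^+ 2) ^+ 2 = a ^+ 2 + b ^+ 2.
    by rewrite sqr_sqrtr// addr_ge0// sqr_ge0.
  have n0 : Num.sqrt (a ^+ 2 + b ^+ 2) != 0 := lt0r_neq0 nz.
  apply: (mulfI n0); rewrite -[RHS]expr2 e mulrDr.
  by rewrite !mulrA mulfV// !mul1r.
rewrite ger0_norm ?normc_ge0//; apply.
rewrite normcM normc_real ger0_norm ?invr_ge0 ?normc_ge0//.
have -> : normc (z^*)%C = normc z by case: z {z0 nz} => a b /=; rewrite sqrrN.
by rewrite mulVf// lt0r_neq0.
Qed.

Lemma continuous_coord_sum (k : nat) (w : 'I_k -> R) :
  continuous (fun c : 'rV[R]_k => \sum_j c 0 j * w j).
Proof.
move=> c; elim: (index_enum _) => [|j r IH].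
  by under eq_fun do rewrite big_nil; exact: cst_continuous.
under eq_fun do rewrite big_cons; refine (cvgD _ IH).
exact: (@continuousM R 'rV[R]_k (fun c => c 0 j) (fun=> w j) c
  (@coord_continuous _ _ _ 0 j c) (@cst_continuous _ _ _ _)).
Qed.

(** The feasible pairs (x, c) need not form a bounded set, but
    [bounded_representative] shows that restricting [c] to a fixed box does not
    change the set of feasible x, which is then the projection of a compact set.
    It serves twice: with x a bound to be minimised at a fixed step size, and
    with x a step size to be maximised under a fixed bound. *)
Lemma compact_feasible (T : Type) (D : set T) (k : nat)
    (u v : T -> R[i]) (phi : T -> 'I_k -> R[i]) (d : R -> R) (M B : R) :
  continuous d ->
  (forall t (x : R), D t -> 0 <= x <= M ->
    normc (u t + x%:C%C * v t) + d x <= B) ->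
  compact [set x : R | 0 <= x <= M /\ exists c : 'rV[R]_k, forall t, D t ->
    normc (u t + x%:C%C * v t + \sum_j (c 0 j)%:C%C * phi t j) <= d x].
Proof.
move=> d_cont bound.
(* The constraint at [t] is split into real ones indexed by the [w] in the
   closed unit disc. *)
pose E : set (T * R[i]) := [set p | D p.1 /\ normc p.2 <= 1].
pose psi (p : T * R[i]) : 'rV[R]_k := \row_j complex.Re (p.2 * phi p.1 j).
have psiE (c : 'rV[R]_k) p :
    complex.Re (p.2 * \sum_j (c 0 j)%:C%C * phi p.1 j)
    = (c *m (psi p)^T) 0 0.
  rewrite mulr_sumr raddf_sum mxE; apply: eq_bigr => j _; rewrite !mxE.
  by case: p.2 (phi p.1 j) => a b [a' b'] /=;
    rewrite !(mul0r, subr0, addr0); ring.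
have ReE (p : T * R[i]) x (c : 'rV[R]_k) :
    complex.Re (p.2 * (u p.1 + x%:C%C * v p.1
                       + \sum_j (c 0 j)%:C%C * phi p.1 j))
    = complex.Re (p.2 * u p.1) + x * complex.Re (p.2 * v p.1)
      + (c *m (psi p)^T) 0 0.
  rewrite -psiE !mulrDr !raddfD /=; congr (_ + _ + _).
  by case: p.2 (v p.1) => a b [a' b'] /=; ring.
pose G (p : T * R[i]) : set (R * 'rV[R]_k) := [set q |
  `|complex.Re (p.2 * u p.1) + q.1 * complex.Re (p.2 * v p.1)
    + (q.2 *m (psi p)^T) 0 0| - d q.1 <= 0].
have GP x (c : 'rV[R]_k) : (forall p, E p -> G p (x, c)) <-> (forall t, D t ->
    normc (u t + x%:C%C * v t + \sum_j (c 0 j)%:C%C * phi t j) <= d x).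
  split=> [Gxc t Dt|fxc [t w] [/= Dt w1]].
    by apply/normc_le_dual => w w1; rewrite (ReE (t, w)) -subr_le0; exact: Gxc.
  rewrite /G /= subr_le0 -(ReE (t, w)).
  by move/normc_le_dual: (fxc t Dt); apply.
have fst_cont : continuous (fun q : R * 'rV[R]_k => q.1).
  by move=> q; exact: cvg_fst.
have G_closed p : closed (G p).
  apply: (preimage_closed _ (@closed_le _ 0)) => q _.
  pose a := complex.Re (p.2 * u p.1); pose b := complex.Re (p.2 * v p.1).
  pose g (c : 'rV[R]_k) := (c *m (psi p)^T) 0 0.
  have g_cont : continuous g.
    by rewrite /g; under eq_fun do rewrite mxE; exact: continuous_coord_sum.
  pose S (q : R * 'rV[R]_k) := g q.2.
  have S_cont : continuous S.
    move=> q'; apply: (@continuous_comp _ _ _ snd g); first exact: cvg_snd.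
    exact: g_cont.
  have a_cont : continuous (fun q : R * 'rV[R]_k => a + q.1 * b).
    move=> q'; apply: (@continuousD R R (R * 'rV[R]_k)%type (fun=> a)
                                    (fun q => q.1 * b)).
      exact: cst_continuous.
    apply: (@continuousM R (R * 'rV[R]_k)%type (fun q => q.1) (fun=> b)).
      exact: fst_cont.
    exact: cst_continuous.
  apply: (@continuousB R R (R * 'rV[R]_k)%type (fun q => `|a + q.1 * b + S q|)
                      (fun q => d q.1)).
    apply: (continuous_comp _ (@norm_continuous _ _ _)).
    exact: continuousD (a_cont q) (S_cont q).
  exact: (continuous_comp (fst_cont q) (@d_cont _)).
have [C repC] := @bounded_representative R k _ E psi.
pose box : set 'rV[R]_k :=
  [set c | forall j, `[- (C * B), C * B]%classic (c 0 j)].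
have box_compact : compact box.
  apply: (@rV_compact R k (fun=> [set` `[- (C * B), C * B]])) => _.
  exact: segment_compact.
set A := [set x | _].
suff -> : A = fst @` ((`[0, M]%classic `*` box) `&` \bigcap_(p in E) G p).
  apply: continuous_compact.
    by apply: continuous_subspaceT => q; exact: cvg_fst.
  apply: compact_closedI; last by apply: closed_bigI => p _; exact: G_closed.
  by apply: compact_setX => //; exact: segment_compact.
apply/seteqP; split=> [x [xM [c cx]]|x [[x' c] [[/= xM _] Gx] <-]]; last first.
  by split; [move: xM; rewrite in_itv | exists c; apply/GP].
have cB p : E p -> `|(c *m (psi p)^T) 0 0| <= B.
  case: p => t w [/= Dt w1]; rewrite -psiE /=.
  move: w w1; apply/normc_le_dual.
  set S := \sum_j _.
  have -> : S = (u t + x%:C%C * v t + S) - (u t + x%:C%C * v t).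
    by rewrite addrAC subrr add0r.
  apply: le_trans (normc_triangle _ _) _; rewrite normc_opp.
  by apply: le_trans (bound t x Dt xM); rewrite addrC lerD2l cx.
have [c' c'E c'B] := repC c B cB.
exists (x, c') => //; split; first split=> //=.
- by move=> j /=; rewrite in_itv /= -ler_norml.
- move=> p Ep; rewrite /G /= c'E //.
  by move: p Ep; apply/GP.
Qed.

(** * Polynomials with a prescribed linear part *)

Lemma bounded_setc (A : set R[i]) : bounded_set (A : set R[i]^o) ->
  exists L : R, forall z, A z -> normc z <= L.
Proof.
move=> [M [Mreal AM]]; exists (complex.Re (M + 1)) => z Az.
have : `|z : R[i]^o| <= M + 1 by apply: AM => //; rewrite ltrDl.
by rewrite lecE => /andP[_].
Qed.

Lemma ceval_bounded (q : {poly R}) (L : R) :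
  exists B : R, forall z, normc z <= L -> normc (ceval q z) <= B.
Proof.
elim/poly_ind: q => [|q c [B qB]].
  by exists 0 => z _; rewrite /ceval rmorph0 horner0 normc0.
exists (B * L + `|c|) => z zL.
rewrite /ceval rmorphD rmorphM /= map_polyX map_polyC /= hornerMXaddC.
apply: le_trans (normc_triangle _ _) _; rewrite normcM normc_real lerD2r.
by rewrite ler_pM ?normc_ge0 ?qB.
Qed.

(** The polynomials of degree at most [k.+1] with first two coefficients 1 and
    [x], parametrised by the other coefficients as a row vector. *)
Definition pinned (k : nat) (x : R) (c : 'rV[R]_k) : {poly R} :=
  1 + x *: 'X + 'X^2 * rVpoly c.

Lemma size_pinned k x (c : 'rV_k) : (size (pinned x c) <= k.+2)%N.
Proof.
rewrite /pinned (leq_trans (size_polyD _ _))// geq_max; apply/andP; split.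
  rewrite (leq_trans (size_polyD _ _))// geq_max size_poly1 /=.
  by rewrite (leq_trans (size_scale_leq _ _))// size_polyX.
rewrite (leq_trans (size_polyMleq _ _))// size_polyXn /= !ltnS.
exact: size_poly.
Qed.

Lemma pinned0 k x (c : 'rV_k) : (pinned x c)`_0 = 1.
Proof. by rewrite !coefD coef1 coefZ coefX coefXnM /= mulr0 !addr0. Qed.

Lemma pinned1 k x (c : 'rV_k) : (pinned x c)`_1 = x.
Proof. by rewrite !coefD coef1 coefZ coefX coefXnM /= mulr1 add0r addr0. Qed.

Lemma pinnedP k x (q : {poly R}) :
  (size q <= k.+2)%N -> q`_0 = 1 -> q`_1 = x ->
  exists c : 'rV_k, q = pinned x c.
Proof.
move=> sq q0 q1; exists (\row_j q`_j.+2); apply/polyP => i.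
have := coefXnM 2 (rVpoly (\row_(j < k) q`_j.+2)) i.
rewrite !coefD coef1 coefZ coefX => ->.
case: i => [|[|i]] /=; rewrite ?(mulr0, mulr1, addr0, add0r)//.
rewrite subSS subSS subn0 coef_rVpoly.
case: insubP => [j _ <-|]; first by rewrite mxE.
by rewrite -leqNgt => ki; rewrite nth_default// (leq_trans sq).
Qed.

Lemma ceval_pinned k x (c : 'rV_k) z :
  ceval (pinned x c) z
  = 1 + x%:C%C * z + \sum_j (c 0 j)%:C%C * z ^+ j.+2.
Proof.
rewrite /ceval /pinned !rmorphD rmorphM /= map_polyZ /= map_polyX map_polyXn.
rewrite rmorph1 !hornerE; congr (_ + _).
rewrite map_rVpoly (@horner_coef_wide _ k) ?size_poly// mulr_sumr.
apply: eq_bigr => j _; rewrite coef_rVpoly_ord mxE mulrCA -exprD.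
by rewrite addnC addn2.
Qed.

Lemma admissibleP k (q : {poly R}) :
  admissible 1 k.+1 q <-> exists c : 'rV_k, q = pinned 1 c.
Proof.
split=> [[sq qE]|[c ->]].
  by apply: pinnedP => //; rewrite qE// invr1.
split=> [|[|[|//]] _]; first exact: size_pinned.
  by rewrite pinned0 invr1.
by rewrite pinned1 invr1.
Qed.

Definition dilate (a : R) (q : {poly R}) : {poly R} := q \Po (a *: 'X).

Lemma coef_dilate a q i : (dilate a q)`_i = q`_i * a ^+ i.
Proof.
rewrite coef_comp_poly; under eq_bigr do rewrite exprZn coefZ coefXn.
have [iq|qi] := ltnP i (size q).
  rewrite (bigD1 (Ordinal iq))//= eqxx mulr1 big1 ?addr0// => j ji.
  by rewrite -val_eqE /= eq_sym in ji; rewrite (negbTE ji) !mulr0.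
rewrite (nth_default _ qi) mul0r big1// => j _.
by rewrite gtn_eqF ?mulr0// (leq_trans (ltn_ord j)).
Qed.

Lemma size_dilate a q : (size (dilate a q) <= size q)%N.
Proof.
by apply/leq_sizeP => j qj; rewrite coef_dilate nth_default ?mul0r.
Qed.

Lemma ceval_dilate a q z : ceval (dilate a q) z = ceval q (a%:C%C * z).
Proof.
by rewrite /ceval map_comp_poly horner_comp map_polyZ /= map_polyX !hornerE.
Qed.

(** The hypotheses on [Lambda] make the set of moduli nonempty and bounded, so
    that [sup] is a genuine least upper bound. *)
Lemma deviation_le q h (Lambda : set R[i]) m :
  Lambda !=set0 -> bounded_set (Lambda : set R[i]^o) ->
  deviation q h Lambda <= m <->
  forall l, Lambda l -> normc (ceval q (h%:C%C * l)) <= m + 1.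
Proof.
move=> [l0 Ll0] /bounded_setc[L LL].
have [B qB] := ceval_bounded q (`|h| * L).
have supS : has_sup [set normc (ceval q (h%:C%C * l)) - 1 | l in Lambda].
  split; first by exists (normc (ceval q (h%:C%C * l0)) - 1); exists l0.
  exists B => _ [l Ll <-]; rewrite lerBlDr ler_wpDr// qB//.
  by rewrite normcM normc_real ler_wpM2l// LL.
split=> [dm l Ll|qm].
  rewrite -lerBlDr (le_trans _ dm)//.
  by apply: ub_le_sup; [case: supS | exists l].
by apply: ge_sup; [case: supS | move=> _ [l Ll <-]; rewrite lerBlDr qm].
Qed.

(** * Attained extrema and the interval of stable steps *)

(** The infimum of 1 + deviation is the least feasible bound x in
    [compact_feasible]. The bounds to consider are capped by the one that
    1 + z achieves. *)
Lemma least_deviationP k h (Lambda : set R[i]) :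
  Lambda !=set0 -> bounded_set (Lambda : set R[i]^o) ->
  is_minimum [set deviation q h Lambda | q in admissible 1 k.+1]
    (least_deviation 1 k.+1 h Lambda).
Proof.
move=> L0 Lbnd; apply: getPex.
pose u (l : R[i]) : R[i] := 1 + h%:C%C * l.
pose phi (l : R[i]) (j : 'I_k) : R[i] := (h%:C%C * l) ^+ j.+2.
(* Here the polynomial does not depend on x, hence the zero slope. *)
have uE (c : 'rV_k) l (x : R) : u l + x%:C%C * 0 + \sum_j (c 0 j)%:C%C * phi l j
    = ceval (pinned 1 c) (h%:C%C * l).
  by rewrite ceval_pinned mulr0 addr0 mul1r.
pose M := deviation (pinned 1 (0 : 'rV_k)) h Lambda + 1.
have uM l : Lambda l -> normc (u l) <= M.
  move=> Ll; have -> : u l = ceval (pinned 1 (0 : 'rV_k)) (h%:C%C * l).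
    by rewrite -(uE 0 l 0) mulr0 addr0 big1 ?addr0// => j _; rewrite mxE mul0r.
  by move: l Ll; apply/deviation_le.
have [l0 Ll0] := L0.
have M0 : 0 <= M := le_trans (normc_ge0 _) (uM l0 Ll0).
pose A := [set x : R | 0 <= x <= M /\ exists c : 'rV[R]_k,
  forall l, Lambda l ->
    normc (u l + x%:C%C * 0 + \sum_j (c 0 j)%:C%C * phi l j) <= x].
have A_compact : compact A.
  apply: (compact_feasible (v := fun=> 0) (d := id) (B := M + M)) => [x|l x Ll].
    exact: cvg_id.
  by move=> /andP[_ xM]; rewrite mulr0 addr0 lerD// uM.
have A_dev (c : 'rV_k) : deviation (pinned 1 c) h Lambda + 1 <= M ->
    A (deviation (pinned 1 c) h Lambda + 1).
  move=> dM; set d := deviation _ _ _.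
  have dc l : Lambda l -> normc (ceval (pinned 1 c) (h%:C%C * l)) <= d + 1.
    by move: l; apply/deviation_le.
  split; last by exists c => l Ll; rewrite uE dc.
  by rewrite dM andbT (le_trans (normc_ge0 _) (dc l0 Ll0)).
have A_neq0 : A !=set0 by exists M; exact: A_dev.
have [|x] := compact_EVT_min (f := id) A_neq0 A_compact.
  by apply: continuous_subspaceT => x; exact: cvg_id.
rewrite inE => -[/andP[_ xM] [c cx]] minx.
have dev_c : deviation (pinned 1 c) h Lambda <= x - 1.
  by apply/deviation_le => // l Ll; rewrite subrK -(uE c l x) cx.
have x_le q : admissible 1 k.+1 q -> x <= deviation q h Lambda + 1.
  move=> /admissibleP[c' ->].
  have [dM|/ltW Md] := leP (deviation (pinned 1 c') h Lambda + 1) M.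
    by apply: minx; rewrite inE; exact: A_dev.
  exact: le_trans Md.
exists (deviation (pinned 1 c) h Lambda); split.
  by exists (pinned 1 c) => //; apply/admissibleP; exists c.
by move=> _ [q qa <-]; rewrite (le_trans dev_c)// lerBlDr x_le.
Qed.

(** Passing from q(z) to q(hz) makes the step size the linear coefficient. At
    h = 0 the substitution is not invertible, but both sides hold there. *)
Lemma stable_stepsP k (Lambda : set R[i]) h : 0 <= h ->
  stable_steps 1 k.+1 Lambda h <->
  exists c : 'rV[R]_k, forall l, Lambda l ->
    normc (1 + h%:C%C * l + \sum_j (c 0 j)%:C%C * l ^+ j.+2) <= 1.
Proof.
move=> h0; split=> [[_ [q [sq qE] stab]]|[c stab]].
  have [|||c qc] := @pinnedP k h (dilate h q).
  - exact: leq_trans (size_dilate _ _) sq.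
  - by rewrite coef_dilate qE// invr1 mulr1.
  - by rewrite coef_dilate qE// invr1 mul1r.
  by exists c => l Ll; rewrite -ceval_pinned -qc ceval_dilate stab.
split => //; have [->|hn0] := eqVneq h 0.
  exists (pinned 1 (0 : 'rV_k)); first by apply/admissibleP; exists 0.
  move=> l _; rewrite mul0r ceval_pinned mulr0 addr0.
  by rewrite big1 ?addr0 ?normc1// => j _; rewrite mxE mul0r.
exists (dilate h^-1 (pinned h c)).
  split=> [|[|[|//]] _].
  - exact: leq_trans (size_dilate _ _) (size_pinned _ _).
  - by rewrite coef_dilate pinned0 invr1 mulr1.
  - by rewrite coef_dilate pinned1 invr1 mulfV.
move=> l Ll; rewrite ceval_dilate mulrA -rmorphM mulVf// mul1r.
by rewrite ceval_pinned stab.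
Qed.

(** Scaling [h] and [c] by [a] in [0, 1] replaces P by (1 - a) + a P, a convex
    combination of 1 and P, so the bound 1 on the modulus is preserved. *)
Lemma stable_steps_down k (Lambda : set R[i]) h h' :
  0 <= h' <= h -> stable_steps 1 k.+1 Lambda h -> stable_steps 1 k.+1 Lambda h'.
Proof.
move=> /andP[h'0 h'h] sh; have h0 := le_trans h'0 h'h.
move: sh => /(stable_stepsP _ _ h0)[c stab]; apply/(stable_stepsP _ _ h'0).
have [h_eq0|hn0] := eqVneq h 0.
  by exists c; have -> : h' = h by apply/eqP; rewrite eq_le h'h h_eq0 h'0.
pose a := h' / h.
have a0 : 0 <= a by rewrite divr_ge0.
have a1 : a <= 1 by rewrite ler_pdivrMr ?mul1r// lt0r hn0.
exists (a *: c) => l Ll.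
have -> : 1 + h'%:C%C * l + \sum_j ((a *: c) 0 j)%:C%C * l ^+ j.+2
  = (1 - a)%:C%C
    + a%:C%C * (1 + h%:C%C * l + \sum_j (c 0 j)%:C%C * l ^+ j.+2).
  rewrite !mulrDr mulr_sumr !addrA mulr1 mulrA -rmorphM /a divfK//.
  congr (_ + _ + _); first by rewrite -rmorphD subrK.
  by apply: eq_bigr => j _; rewrite mxE rmorphM mulrA.
apply: le_trans (normc_triangle _ _) _; rewrite normcM !normc_real.
rewrite !ger0_norm ?subr_ge0//.
rewrite -[leRHS](subrK a) lerD2l -[leRHS]mulr1 ler_wpM2l// stab//.
Qed.

(** Below the bound [b] the stable steps are the feasible x of
    [compact_feasible] for the constant bound 1, so they form a compact set. *)
Lemma H_optP k (Lambda : set R[i]) b :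
  bounded_set (Lambda : set R[i]^o) -> ubound (stable_steps 1 k.+1 Lambda) b ->
  is_maximum (stable_steps 1 k.+1 Lambda) (H_opt 1 k.+1 Lambda).
Proof.
move=> /bounded_setc[L LL] ub; apply: getPex.
have stab0 : stable_steps 1 k.+1 Lambda 0.
  apply/stable_stepsP => //; exists 0 => l _.
  rewrite mul0r addr0 big1 ?addr0 ?normc1// => j _.
  by rewrite mxE mul0r.
pose A := [set x : R | 0 <= x <= b /\ exists c : 'rV[R]_k, forall l, Lambda l ->
  normc (1 + x%:C%C * l + \sum_j (c 0 j)%:C%C * l ^+ j.+2) <= 1].
have AE : A = stable_steps 1 k.+1 Lambda.
  apply/seteqP; split=> [x [/andP[x0 _] xc]|x Sx]; first exact/stable_stepsP.
  have x0 : 0 <= x by case: Sx.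
  by split; [rewrite x0 ub | exact/stable_stepsP].
have A_compact : compact A.
  apply: (compact_feasible (u := fun=> 1) (v := id) (d := fun=> 1)
            (B := 1 + b * L + 1)) => [x|l x Ll /andP[x0 xb]].
    exact: cst_continuous.
  rewrite lerD2r; apply: le_trans (normc_triangle _ _) _.
  by rewrite normc1 lerD2l normcM normc_real ger0_norm// ler_pM ?normc_ge0 ?LL.
rewrite -AE in stab0 *.
have [|x] := compact_EVT_max (f := id) (ex_intro _ _ stab0) A_compact.
  by apply: continuous_subspaceT => x; exact: cvg_id.
rewrite inE => Ax maxx; exists x; split => // y Ay.
by apply: maxx; rewrite inE.
Qed.

(** Stability of [h] gives a polynomial of nonpositive deviation, and conversely
    [least_deviation] is the deviation of some polynomial, because the minimum
    is attained. *)
Lemma least_deviation_le0 k h (Lambda : set R[i]) :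
  Lambda !=set0 -> bounded_set (Lambda : set R[i]^o) -> 0 <= h ->
  least_deviation 1 k.+1 h Lambda <= 0 <-> stable_steps 1 k.+1 Lambda h.
Proof.
move=> L0 Lbnd h0; have [[q qa qE] minq] := least_deviationP k h L0 Lbnd.
split=> [|[_ [p pa stab]]].
  rewrite -qE => /(deviation_le _ _ _ L0 Lbnd); rewrite add0r => stab.
  by split => //; exists q.
apply: (@le_trans _ _ (deviation p h Lambda)); first by apply: minq; exists p.
by apply/(deviation_le _ _ _ L0 Lbnd); rewrite add0r.
Qed.

(** * The bisection algorithm *)

(** Each pass halves the interval, so [n] passes suffice. *)
Lemma bisection_terminates s (Lambda : set R[i]) (eps : R) (n : nat) (a b : R) :
  b - a <= eps *+ 2 ^ n -> exists H, bisection 1 s Lambda eps a b H.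
Proof.
elim: n a b => [|n IH] a b ab; first by exists a; exact: bisection_stop.
have [stop|go] := leP (b - a) eps; first by exists a; exact: bisection_stop.
rewrite expnS mulnC mulrnA mulr2n in ab.
have [acc|rej] := leP (least_deviation 1 s ((b + a) / 2) Lambda) 0.
  have [|H HH] := IH ((b + a) / 2) b; first by lra.
  by exists H; exact: bisection_accept.
have [|H HH] := IH a ((b + a) / 2); first by lra.
by exists H; exact: bisection_reject.
Qed.

(** The loop invariant, a stable lower end and an unstable upper end, read off
    at the exit of the loop; [b'] is the final upper end. *)
Lemma bisection_bracket k (Lambda : set R[i]) (eps a b H : R) :
  Lambda !=set0 -> bounded_set (Lambda : set R[i]^o) ->
  bisection 1 k.+1 Lambda eps a b H -> 0 <= a <= b ->
  stable_steps 1 k.+1 Lambda a -> ~ stable_steps 1 k.+1 Lambda b ->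
  stable_steps 1 k.+1 Lambda H /\
  exists2 b', 0 <= b' <= H + eps & ~ stable_steps 1 k.+1 Lambda b'.
Proof.
move=> L0 Lbnd; elim=> {a b H} [a b ab|a b H ab acc _ IH|a b H ab rej _ IH]
  /andP[a0 leab] Sa NSb.
- by split => //; exists b => //; apply/andP; split; lra.
- apply: IH => //; first by apply/andP; split; lra.
  by apply/least_deviation_le0 => //; lra.
- apply: IH => //; first by apply/andP; split; lra.
  have m0 : 0 <= (b + a) / 2 by lra.
  by move=> /(least_deviation_le0 k L0 Lbnd m0); rewrite leNgt rej.
Qed.

End StabilityPolynomials.

Unset Implicit Arguments.

Theorem theorem1 (R : realType) (s : nat) (hs : (1 <= s)%N)
    (Lambda : set R[i]) (Lambda_neq0 : Lambda !=set0)
    (Lambda_bnd : bounded_set (Lambda : set R[i]^o))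
    (hmax : R) (hmax_gt0 : 0 < hmax)
    (hmax_large : 0 < least_deviation 1 s hmax Lambda) :
  H_bisection 1 s Lambda hmax eps @[eps --> 0^'+] --> H_opt 1 s Lambda.
Proof.
case: s hs hmax_large => // k _ hmax_large.
set S := stable_steps 1 k.+1 Lambda.
have hmax_unstable : ~ S hmax.
  move=> /(least_deviation_le0 k Lambda_neq0 Lambda_bnd (ltW hmax_gt0)).
  by rewrite leNgt hmax_large.
have below b h : 0 <= b -> ~ S b -> S h -> h <= b.
  move=> b0 Nb Sh; rewrite leNgt; apply/negP => /ltW bh.
  by apply: Nb; apply: stable_steps_down Sh; rewrite b0.
have [Sopt opt_max] := H_optP Lambda_bnd
  (fun h => below hmax h (ltW hmax_gt0) hmax_unstable).
have S0 : S 0.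
  by apply: (stable_steps_down _ Sopt); rewrite lexx; case: Sopt.
apply/cvgrPdist_le => e e0; near=> eps.
have eps0 : 0 < eps by near: eps; exact: nbhs_right_gt.
have eps_le : eps <= e by near: eps; exact: nbhs_right_le.
have [H runH] : exists H, bisection 1 k.+1 Lambda eps 0 hmax H.
  apply: (@bisection_terminates _ _ _ _ (Num.bound (hmax / eps))).
  rewrite subr0 -[leRHS]mulr_natl -ler_pdivrMr// ltW//.
  apply: lt_trans (archi_boundP _) _; first by rewrite divr_ge0// ltW.
  by rewrite ltr_nat ltn_expl.
have run : bisection 1 k.+1 Lambda eps 0 hmax
    (H_bisection 1 k.+1 Lambda hmax eps).
  exact: getPex (ex_intro _ _ runH).
have [|//|//|Sbis [b /andP[b0 b_le] Nb]] :=
    bisection_bracket Lambda_neq0 Lambda_bnd run.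
  by rewrite lexx ltW.
have lo := opt_max _ Sbis; have hi := below _ _ b0 Nb Sopt.
rewrite ger0_norm ?subr_ge0// lerBlDl.
by apply: le_trans hi _; apply: le_trans b_le _; rewrite lerD2l.
Unshelve. all: by end_near.
Qed.
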